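(* Let $n\geq 1$ and let $\Omega\subset\mathbb{R}^n$ be any open set. Then there exists a sequence $(\Omega_m)_{m\geq 1}$ of bounded open subsets of $\mathbb{R}^n$, each with analytic boundary, such that $\Omega_m\subset\Omega_{m+1}$ for all $m\ge 1$, $\bigcup_{m\geq 1}\Omega_m=\Omega$, and $\overline{\Omega}_m\subset\Omega$ for all $m\geq 1$.
   Context: Open sets are not assumed to be connected, bounded or nonempty. The boundary of an open set $D\subset\mathbb{R}^n$ is called analytic if it is an analytic manifold (that is, $\partial D$ is an embedded real-analytic hypersurface, of dimension $n-1$, in $\mathbb{R}^n$) and $D$ is locally located on one side of it. Explicitly: for every $x\in\partial D$ there are an open neighbourhood $U$ of $x$ in $\mathbb{R}^n$ and a real-analytic function $f:U\to\mathbb{R}$ with nowhere vanishing gradient such that $D\cap U=\{y\in U: f(y)<0\}$ and $\partial D\cap U=\{y\in U: f(y)=0\}$. An empty boundary satisfies this condition vacuously, so the empty set is a bounded open set with analytic boundary. $\overline{D}$ denotes the closure of $D$ in $\mathbb{R}^n$. *)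

(* Defs.v *)
From HB Require Import structures.
From mathcomp Require Export all_boot all_order all_algebra.
From mathcomp Require Export finmap.
From mathcomp Require Export all_classical all_reals all_analysis.
(* Not imported: its [sum] and [summable] would shadow other library names. *)
From mathcomp.analysis.showcase Require summability.
Export numFieldNormedType.Exports.
Export Order.TTheory GRing.Theory Num.Theory.

Set Implicit Arguments.
Unset Strict Implicit.
Unset Printing Implicit Defensive.

Local Open Scope classical_set_scope.
Local Open Scope ring_scope.

Definition boundary {T : topologicalType} (D : set T) : set T :=
  closure D `\` D°.

Section Analytic.
Variables (R : realType) (n : nat).
Implicit Types (f : 'rV[R]_n -> R) (U D : set 'rV[R]_n) (x a : 'rV[R]_n).

Definition monomial_at (k : {ffun 'I_n -> nat}) x : R :=
  \prod_(i < n) x 0 i ^+ k i.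

(* The power series over all multi-indices is summed unconditionally, i.e.
   along the directed set of finite sets of multi-indices; in R this is the
   same as absolute convergence. *)
Definition analytic_on U f : Prop :=
  forall a, U a -> exists c : {ffun 'I_n -> nat} -> R,
    \forall x \near a,
      summability.partial_sum (fun k => c k * monomial_at k (x - a))
        @ summability.totally --> f x.

Definition gradient f x : 'rV[R]_n := \row_(i < n) 'D_(delta_mx 0 i) f x.

(* Since 'rV[R]_n is the ambient type, f is a total function; only its values
   on U matter, as U is open. *)
Definition analytic_boundary D : Prop :=
  forall x, boundary D x ->
    exists U f,
      [/\ open U /\ U x,
          analytic_on U f,
          forall y, U y -> gradient f y != 0,
          D `&` U = [set y | U y /\ f y < 0]
        & boundary D `&` U = [set y | U y /\ f y = 0]].

End Analytic.

(* Main.v *)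
Require Import Defs.
From mathcomp Require Import ring zify.

(** Cover a compact part E of Omega by finitely many small balls with rational
    centres.  The sum of large odd powers of L - |x - a|^2, over the centres a,
    is much larger on E than at any point outside the balls of twice the radius
    (analytic_barrier); its superlevel sets at suitable levels c thus contain E
    and stay, with their closures, in a slightly larger compact part of Omega.

    This sum is a polynomial, so such a superlevel set has an analytic boundary
    as soon as c is not a critical value.  After rescaling, the coefficients
    are integers, and then every transcendental c is admissible
    (critical_value_not_transcendental): if c = p(x) were transcendental, there
    would be a derivation D, defined on a ring that contains c and the
    coordinates of x, with D c = 1 (transcendental_derivation), whereas the
    chain rule gives D c = 0 when the gradient of p vanishes at x.
    Transcendental numbers lie in every interval since the algebraic ones are
    countable.

    For E take core Omega m, the points of norm at most 2^m at distance at least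
    2^-m from the complement of Omega.  The resulting set lies between
    core Omega m and core Omega m.+1 (analytic_between_cores), which makes the
    sequence increasing; the cores exhaust Omega. *)

Set Implicit Arguments.
Unset Strict Implicit.
Unset Printing Implicit Defensive.
Local Open Scope classical_set_scope.
Local Open Scope ring_scope.

(** * Derivations of rings evaluated in a field *)

Section DerivationAlong.
Variable K : numFieldType.

(** A derivation from the subring phi(A) of K to K, presented on A.  With
    the presentation phi : A -> K in place of its image, adjoining an element of
    K amounts to passing from A to {poly A}; der_ker says that delta descends to
    phi(A). *)
Record derivation_along (A : idomainType) (phi : {rmorphism A -> K})
    (delta : A -> K) : Prop := DerivationAlong {
  derD : {morph delta : x y / x + y};
  derM : forall x y, delta (x * y) = phi x * delta y + phi y * delta x;
  der_ker : forall x, phi x = 0 -> delta x = 0 }.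

(** The presentation of phi(A)[a] by {poly A}. *)
Definition eval_at (A : idomainType) (phi : {rmorphism A -> K}) (a : K) :
    {rmorphism {poly A} -> K} :=
  GRing.RMorphism.clone _ _ (horner_eval a \o map_poly phi) _.

Lemma eval_atE (A : idomainType) (phi : {rmorphism A -> K}) a (g : {poly A}) :
  eval_at phi a g = (map_poly phi g).[a].
Proof. by []. Qed.

Section Theory.
Variables (A : idomainType) (phi : {rmorphism A -> K}) (delta : A -> K).
Hypothesis der : derivation_along phi delta.

Lemma der0 : delta 0 = 0.
Proof. by apply: (der_ker der); rewrite rmorph0. Qed.

Lemma derN x : delta (- x) = - delta x.
Proof. by apply/eqP; rewrite -addr_eq0 -(derD der) addNr der0. Qed.

Lemma derB x y : delta (x - y) = delta x - delta y.
Proof. by rewrite (derD der) derN. Qed.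

Lemma der_sum (I : Type) (r : seq I) (P : pred I) (F : I -> A) :
  delta (\sum_(i <- r | P i) F i) = \sum_(i <- r | P i) delta (F i).
Proof. exact: (big_morph delta (derD der) der0). Qed.

Lemma der1 : delta 1 = 0.
Proof.
have := derM der 1 1; rewrite mulr1 rmorph1 mul1r => /eqP.
by rewrite -subr_eq0 opprD addrA subrr sub0r oppr_eq0 => /eqP.
Qed.

Lemma der_int (z : int) : delta z%:~R = 0.
Proof.
case: z => n; rewrite ?NegzE ?mulrNz ?derN.
  elim: n => [|n IH]; first exact: der0.
  by rewrite -addn1 PoszD rmorphD (derD der) IH der1 addr0.
elim: n => [|n IH]; first by rewrite der1 oppr0.
by rewrite -addn1 PoszD rmorphD (derD der) der1 addr0.
Qed.

Variable a : K.

(** The derivation of {poly A} that extends delta and sends 'X to u. *)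
Definition poly_der (u : K) (g : {poly A}) : K :=
  (map_poly delta g).[a] + u * (map_poly phi g)^`().[a].

Lemma poly_derD u : {morph poly_der u : g h / g + h}.
Proof.
move=> g h; rewrite /poly_der.
have -> : map_poly delta (g + h) = map_poly delta g + map_poly delta h.
  apply/polyP => i; rewrite coefD !coef_map_id0 ?der0 // coefD.
  exact: derD der _ _.
by rewrite rmorphD derivD !hornerD mulrDr addrACA.
Qed.

Lemma poly_derM u (g h : {poly A}) :
  poly_der u (g * h) =
    eval_at phi a g * poly_der u h + eval_at phi a h * poly_der u g.
Proof.
rewrite !eval_atE /poly_der.
have -> : map_poly delta (g * h) =
    map_poly phi g * map_poly delta h + map_poly phi h * map_poly delta g.
  apply/polyP => i; rewrite coefD coef_map_id0 ?der0 // !coefM der_sum.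
  rewrite (_ : \sum_(j < i.+1) _ =
     \sum_(j < i.+1) (phi g`_j * delta h`_(i - j))
     + \sum_(j < i.+1) phi h`_(i - j) * delta g`_j).
    congr (_ + _).
      by apply: eq_bigr => j _; rewrite coef_map coef_map_id0 ?der0.
    rewrite -coefM mulrC coefM.
    by apply: eq_bigr => j _; rewrite coef_map coef_map_id0 ?der0 // mulrC.
  by rewrite -big_split; apply: eq_bigr => j _; rewrite (derM der).
rewrite rmorphM derivM !(hornerD, hornerM).
ring.
Qed.


Lemma poly_der_vanish u (g : {poly A}) : map_poly phi g = 0 -> poly_der u g = 0.
Proof.
move=> g0; rewrite /poly_der g0 deriv0 horner0 mulr0 addr0.
have -> : map_poly delta g = 0.
  apply/polyP => i; rewrite coef_map_id0 ?der0 // coef0; apply: (der_ker der).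
  by rewrite -coef_map g0 coef0.
by rewrite horner0.
Qed.

Lemma poly_derC u x : poly_der u x%:P = delta x.
Proof.
rewrite /poly_der map_polyC derivC horner0 mulr0 addr0.
suff -> : map_poly delta x%:P = (delta x)%:P by rewrite hornerC.
apply/polyP => i; rewrite coef_map_id0 ?der0 // !coefC.
by case: eqP => _; rewrite ?der0.
Qed.

Lemma poly_derX u : poly_der u 'X = u.
Proof.
rewrite /poly_der map_polyX derivX hornerC mulr1.
suff -> : map_poly delta 'X = 0 by rewrite horner0 add0r.
apply/polyP => i; rewrite coef_map_id0 ?der0 // coefX coef0.
by case: eqP => _; rewrite ?der1 ?der0.
Qed.

Lemma eval_atC x : eval_at phi a x%:P = phi x.
Proof. by rewrite eval_atE map_polyC hornerC. Qed.

Lemma eval_atX : eval_at phi a 'X = a.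
Proof. by rewrite eval_atE map_polyX hornerX. Qed.

Lemma poly_derP u :
  (forall g, eval_at phi a g = 0 -> poly_der u g = 0) ->
  derivation_along (eval_at phi a) (poly_der u).
Proof. by split=> //; [exact: poly_derD|exact: poly_derM]. Qed.

(** If a is transcendental over phi(A), every u works.  Otherwise let m be a
    relation of least degree satisfied by a.  Since the characteristic is 0, a
    is a simple root of m, so that u can be chosen to make poly_der u m vanish,
    and every other relation is, after multiplication by a power of the leading
    coefficient, a multiple of m plus a remainder that phi kills. *)
Lemma extend_derivation :
  exists u, derivation_along (eval_at phi a) (poly_der u).
Proof.
pose relation (g : {poly A}) := map_poly phi g != 0 /\ eval_at phi a g = 0.
have [[m0 relm0]|norelation] := pselect (exists g, relation g); last first.
  exists 0; apply: poly_derP => g g0; apply: poly_der_vanish.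
  by apply: contrapT => /eqP gN0; apply: norelation; exists g.
have exm : exists k, `[< exists2 g, relation g & size g = k >].
  by exists (size m0); apply/asboolP; exists m0.
have [k /asboolP[m [mN0 am0] <-] mmin] := ex_minnP exm.
have minm (g : {poly A}) :
    (size g < size m)%N -> eval_at phi a g = 0 -> map_poly phi g = 0.
  move=> gm g0; apply: contrapT => /eqP gN0.
  move: gm; rewrite ltnNge mmin //; apply/asboolP.
  by exists g.
have m_neq0 : m != 0 by apply: contraNneq mN0 => ->; rewrite rmorph0.
(* otherwise m minus its leading term would be a shorter relation *)
have lcN0 : phi (lead_coef m) != 0.
  apply: contraNneq mN0 => lc0.
  pose m' := m - (lead_coef m)%:P * 'X^((size m).-1).
  have mE : map_poly phi m' = map_poly phi m.
    by rewrite rmorphB rmorphM /= map_polyC /= lc0 mul0r subr0.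
  rewrite -mE; apply/eqP/minm; last by rewrite eval_atE mE.
  rewrite -(prednK (n := size m)) ?size_poly_gt0 // ltnS; apply/leq_sizeP => j.
  rewrite coefB coefCM coefXn leq_eqVlt => /orP[/eqP <-|lt_j].
    by rewrite eqxx mulr1 lead_coefE subrr.
  rewrite gtn_eqF // mulr0 subr0 nth_default //.
  by rewrite -(prednK (n := size m)) ?size_poly_gt0.
(* otherwise the derivative of m would be a shorter relation *)
have dmN0 : (map_poly phi m)^`().[a] != 0.
  apply/eqP => dm0; have dmap : map_poly phi m^`() = 0.
    by apply: minm; rewrite ?lt_size_deriv // eval_atE -deriv_map.
  have mC : map_poly phi m = ((map_poly phi m)`_0)%:P.
    apply/polyP => -[|i]; rewrite coefC //=; apply/eqP.
    have /eqP : (map_poly phi m)^`()`_i = 0 by rewrite deriv_map dmap coef0.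
    by rewrite coef_deriv mulrn_eq0.
  by move: am0; rewrite eval_atE mC hornerC => c0; rewrite mC c0 eqxx in mN0.
exists (- (map_poly delta m).[a] / (map_poly phi m)^`().[a]).
set u := _ / _; apply: poly_derP => g g0.
have dm0 : poly_der u m = 0 by rewrite /poly_der divfK // subrr.
have gE := Pdiv.Idomain.divp_eq g m.
set l := _ ^+ _ in gE; set q := g %/ m in gE; set r := g %% m in gE.
have lN0 : phi l != 0 by rewrite rmorphXn expf_neq0.
have r0 : eval_at phi a r = 0.
  have -> : r = l%:P * g - q * m :> {poly A}.
    by rewrite mul_polyC gE addrC addKr.
  by rewrite rmorphB !rmorphM g0 am0 !mulr0 subr0.
have dr0 : poly_der u r = 0.
  by apply/poly_der_vanish/minm; rewrite ?Pdiv.Idomain.ltn_modp.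
have : poly_der u (l%:P * g) = 0.
  by rewrite mul_polyC gE poly_derD poly_derM am0 dm0 dr0 mul0r mulr0 !addr0.
rewrite poly_derM g0 mul0r addr0 eval_atC => /eqP.
by rewrite mulf_eq0 (negPf lN0) => /eqP.
Qed.

End Theory.

Lemma intr_derivation :
  derivation_along (intr : {rmorphism int -> K}) (fun=> 0).
Proof. by split=> [x y|x y|x _] //=; rewrite ?mulr0 addr0. Qed.

Definition transcendental (c : K) :=
  forall p : {poly int}, p != 0 -> (map_poly intr p).[c] != 0.

(** On Z[c], which is a polynomial ring, d/dc is a derivation; it extends to
    the finitely many elements of s one at a time. *)
Lemma transcendental_derivation c (s : seq K) : transcendental c ->
  exists (A : idomainType) (phi : {rmorphism A -> K}) (delta : A -> K),
    [/\ derivation_along phi delta,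
        exists2 t, phi t = c & delta t = 1
      & forall x, x \in s -> exists y, phi y = x].
Proof.
move=> tc; elim: s => [|a s [A [phi [delta [der [t phit delt] gen]]]]].
  exists {poly int}, (eval_at intr c), (poly_der intr (fun=> 0) c 1); split=> //.
    apply: (poly_derP intr_derivation) => g /eqP.
    have [-> _|gN0] := eqVneq g 0; last by rewrite eval_atE (negPf (tc _ gN0)).
    by apply: (poly_der_vanish intr_derivation); rewrite rmorph0.
  by exists 'X; [exact: eval_atX|exact: (poly_derX intr_derivation)].
have [u deru] := extend_derivation der a.
exists {poly A}, (eval_at phi a), (poly_der phi delta a u); split=> //.
  by exists t%:P; rewrite ?eval_atC ?(poly_derC der).
move=> x; rewrite inE => /predU1P[->|/gen[y yx]].
  by exists 'X; rewrite eval_atX.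
by exists y%:P; rewrite eval_atC.
Qed.

End DerivationAlong.

(** * Critical values of integer polynomials *)

(** Expressions, so that one polynomial can be evaluated in any ring and every
    property below is an induction on the expression. *)
Inductive intpoly (n : nat) : Type :=
| PCst of int
| PVar of 'I_n
| PAdd of intpoly n & intpoly n
| PMul of intpoly n & intpoly n.
Arguments PCst {n} _.
Arguments PVar {n} _.

Section IntPoly.
Variable n : nat.
Implicit Types e : intpoly n.

Fixpoint peval (A : comNzRingType) (x : 'I_n -> A) e : A :=
  match e with
  | PCst z => z%:~R
  | PVar i => x i
  | PAdd e1 e2 => peval x e1 + peval x e2
  | PMul e1 e2 => peval x e1 * peval x e2
  end.

Fixpoint pderiv (i : 'I_n) e : intpoly n :=
  match e with
  | PCst _ => PCst 0
  | PVar j => PCst (i == j)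
  | PAdd e1 e2 => PAdd (pderiv i e1) (pderiv i e2)
  | PMul e1 e2 => PAdd (PMul e1 (pderiv i e2)) (PMul e2 (pderiv i e1))
  end.

Lemma rmorph_peval (A B : comNzRingType) (phi : {rmorphism A -> B}) x e :
  phi (peval x e) = peval (phi \o x) e.
Proof.
elim: e => [z|i|e1 IH1 e2 IH2|e1 IH1 e2 IH2] /=; first exact: rmorph_int.
- by [].
- by rewrite rmorphD IH1 IH2.
- by rewrite rmorphM IH1 IH2.
Qed.

Lemma chain_rule (K : numFieldType) (A : idomainType)
    (phi : {rmorphism A -> K}) (delta : A -> K) (x : 'I_n -> A) e :
  derivation_along phi delta ->
  delta (peval x e) = \sum_i peval (phi \o x) (pderiv i e) * delta (x i).
Proof.
move=> der; elim: e => [z|j|e1 IH1 e2 IH2|e1 IH1 e2 IH2] /=.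
- by rewrite (der_int der) big1 // => i _; rewrite mul0r.
- rewrite (bigD1 j) //= eqxx mul1r big1 ?addr0 // => i /negPf ->.
  by rewrite mul0r.
- rewrite (derD der) IH1 IH2 -big_split; apply: eq_bigr => i _ /=.
  by rewrite mulrDl.
- rewrite (derM der) IH1 IH2 !mulr_sumr -big_split; apply: eq_bigr => i _ /=.
  by rewrite !rmorph_peval mulrDl !mulrA.
Qed.

(** An algebraic form of Sard's theorem.  If c = e(x) were transcendental, some
    derivation delta would satisfy delta c = 1; but by the chain rule delta c is
    the sum of the partial derivatives of e at x times delta (x i), which is 0. *)
Lemma critical_value_not_transcendental (K : numFieldType) (x : 'I_n -> K) e :
  (forall i, peval x (pderiv i e) = 0) -> ~ transcendental (peval x e).
Proof.
move=> crit tc.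
have [A [phi [delta [der [t phit delt] gen]]]] :=
  transcendental_derivation [seq x i | i <- enum 'I_n] tc.
have /choice[X phiX] i : exists y, phi y = x i.
  by apply: gen; apply: map_f; rewrite mem_enum.
have phiXE : phi \o X = x by apply: funext => i /=.
have : delta (peval X e - t) = 0.
  by apply: (der_ker der); rewrite rmorphB rmorph_peval phiXE phit subrr.
rewrite (derB der) delt (chain_rule X e der) phiXE big1 ?sub0r.
  by move=> /eqP; rewrite oppr_eq0 oner_eq0.
by move=> i _; rewrite crit mul0r.
Qed.

End IntPoly.

(** * Integer polynomials as functions on real row vectors *)

Section RealPoly.
Variables (R : realType) (n : nat).
Implicit Types (e : intpoly n) (x a v : 'rV[R]_n).

Definition pfun e x : R := peval (fun i => x 0 i) e.

Lemma pfun_continuous e : continuous (pfun e).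
Proof.
elim: e => [z|i|e1 IH1 e2 IH2|e1 IH1 e2 IH2] x.
- exact: (@cst_continuous _ _ (z%:~R : R)).
- exact: coord_continuous.
- exact: cvgD (IH1 x) (IH2 x).
- exact: cvgM (IH1 x) (IH2 x).
Qed.

Lemma is_derive_coord (i : 'I_n) x v :
  is_derive x v (fun y : 'rV[R]_n => y 0 i) (v 0 i).
Proof.
have quotE : (fun h => h^-1 *: (((h *: v + x) 0 i : R) - x 0 i)) @ 0^' --> v 0 i.
  apply: cvg_near_cst; near=> h.
  have h0 : h != 0 by near: h; exact: nbhs_dnbhs_neq.
  by rewrite !mxE addrK /GRing.scale /= mulrA mulVf // mul1r.
apply: DeriveDef; first by apply/cvg_ex; exists (v 0 i).
exact: cvg_lim quotE.
Unshelve. all: by end_near. Qed.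

Lemma is_derive_pfun e (i : 'I_n) x :
  is_derive x (delta_mx 0 i) (pfun e) (pfun (pderiv i e) x).
Proof.
elim: e => [z|j|e1 IH1 e2 IH2|e1 IH1 e2 IH2].
- exact: is_derive_cst.
- apply: (is_derive_eq (is_derive_coord j x (delta_mx 0 i))).
  by rewrite mxE eqxx /pfun /= eq_sym; case: eqP.
- exact: (is_deriveD IH1 IH2).
- exact: (is_deriveM IH1 IH2).
Qed.

(** To first order, f decreases linearly when moving from x along v or along
    - v, according to the sign of the derivative. *)
Lemma closure_neg_of_derive (f : 'rV[R]_n -> R) x v df :
  is_derive x v f df -> df != 0 -> f x = 0 -> closure [set y | f y < 0] x.
Proof.
move=> der dfN0 fx0.
have quot : h^-1 *: (f (h *: v + x) - f x) @[h --> 0^'] --> df.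
  by rewrite -[X in _ --> X](derive_val (is_derive := der)); exact: ex_derive.
(* F is 0^'+ or 0^'-, whichever makes h * df negative *)
have descent (F : set_system R) : ProperFilter F -> h @[h --> F] --> (0 : R) ->
    h^-1 *: (f (h *: v + x) - f x) @[h --> F] --> df ->
    (\forall h \near F, h * df < 0) -> closure [set y | f y < 0] x.
  move=> FF F0 Fquot Fdf B Bx.
  have toB : \forall h \near F, B (h *: v + x).
    have : h *: v + x @[h --> F] --> 0 *: v + x.
      by apply: cvgD; [exact: cvgZr_tmp|exact: cvg_cst].
    by rewrite scale0r add0r => /(_ _ Bx).
  have : \forall h \near F, 0 < h^-1 *: (f (h *: v + x) - f x) * df.
    apply: (cvgr_gt (df * df)); first exact: cvgM Fquot (cvg_cst _).
    by rewrite -expr2 exprn_even_gt0.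
  move=> quot_pos.
  have [h [[Bh hdf] qh]] := filter_ex (filterI (filterI toB Fdf) quot_pos).
  exists (h *: v + x); split=> //=.
  have h0 : h != 0 by apply: contraTneq hdf => ->; rewrite mul0r ltxx.
  have : h^-1 *: (f (h *: v + x) - f x) * df * (h * df) < 0.
    by rewrite pmulr_rlt0.
  rewrite fx0 subr0 /GRing.scale /= mulrACA [h^-1 * _ * h]mulrAC mulVf // mul1r.
  by rewrite pmulr_llt0 // -expr2 exprn_even_gt0.
have [dflt0|dfgt0|df0] := ltgtP df 0; last by rewrite df0 eqxx in dfN0.
- apply: (descent 0^'+).
  + exact/cvg_at_right_filter/cvg_id.
  + exact: cvg_dnbhs_at_right.
  + by near=> h; rewrite nmulr_llt0 //; near: h; exact: nbhs_right_gt.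
- apply: (descent 0^'-).
  + exact/cvg_at_left_filter/cvg_id.
  + exact: cvg_dnbhs_at_left.
  + by near=> h; rewrite pmulr_llt0 //; near: h; exact: nbhs_left_lt.
Unshelve. all: end_near.
Qed.
End RealPoly.

(** * Polynomials are analytic *)

Section Expansion.
Variables (R : realType) (n : nat).
Implicit Types (f g : 'rV[R]_n -> R) (x a : 'rV[R]_n).

(** The list may repeat a multi-index, which makes this stable under sums and
    products with no collection of like terms. *)
Definition finitely_expandable a f :=
  exists s : seq (R * {ffun 'I_n -> nat}),
    forall x, f x = \sum_(p <- s) p.1 * monomial_at p.2 (x - a).

Lemma expandable_cst a (c : R) : finitely_expandable a (fun=> c).
Proof.
exists [:: (c, [ffun=> 0%N])] => x; rewrite big_seq1 /monomial_at big1 ?mulr1 //.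
by move=> i _; rewrite ffunE expr0.
Qed.

Lemma expandableD a f g : finitely_expandable a f -> finitely_expandable a g ->
  finitely_expandable a (fun x => f x + g x).
Proof. by move=> [s fs] [t gt]; exists (s ++ t) => x; rewrite big_cat fs gt. Qed.

Lemma expandableM a f g : finitely_expandable a f -> finitely_expandable a g ->
  finitely_expandable a (fun x => f x * g x).
Proof.
move=> [s fs] [t gt].
pose pmul (p q : R * {ffun 'I_n -> nat}) :=
  (p.1 * q.1, [ffun i => (p.2 i + q.2 i)%N]).
exists (allpairs pmul s t) => x.
rewrite big_allpairs_dep fs gt big_distrlr /=.
apply: eq_bigr => p _; apply: eq_bigr => q _ /=.
rewrite mulrACA -big_split /=; congr (_ * _).
by apply: eq_bigr => i _; rewrite ffunE exprD.
Qed.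

Lemma expandable_coord a (i : 'I_n) : finitely_expandable a (fun x => x 0 i).
Proof.
have -> : (fun x : 'rV[R]_n => x 0 i) = fun x => (x - a) 0 i + a 0 i.
  by apply: funext => x; rewrite !mxE subrK.
apply: expandableD; last exact: expandable_cst.
exists [:: (1, [ffun j => (j == i) : nat])] => x.
rewrite big_seq1 mul1r /monomial_at (bigD1 i) //= ffunE eqxx expr1.
by rewrite big1 ?mulr1 // => j /negPf ji; rewrite ffunE ji expr0.
Qed.

Lemma expandable_pfun a (e : intpoly n) : finitely_expandable a (pfun e).
Proof.
elim: e => [z|i|e1 IH1 e2 IH2|e1 IH1 e2 IH2].
- exact: expandable_cst.
- exact: expandable_coord.
- exact: expandableD.
- exact: expandableM.
Qed.

(** The coefficient of a multi-index collects its occurrences in the list; the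
    partial sums are then constant once they include all the multi-indices of
    the list. *)
Lemma analytic_of_expandable (U : set 'rV[R]_n) f :
  (forall a, finitely_expandable a f) -> analytic_on U f.
Proof.
move=> fE a _; have [s fs] := fE a.
exists (fun k => \sum_(p <- s | p.2 == k) p.1); near=> x.
have totF := @summability.totally_filter {ffun 'I_n -> nat}.
apply: cvg_near_cst.
exists [fset k in map snd s]%fset => // B /= /fsubsetP sB.
rewrite /summability.partial_sum fs.
rewrite -(big_seq_fsetE _ _ xpredT (fun k =>
  (\sum_(p <- s | p.2 == k) p.1) * monomial_at k (x - a))) /=.
under eq_bigr do rewrite mulr_suml.
rewrite (exchange_big_dep xpredT) //= big_seq [RHS]big_seq.
apply: eq_bigr => p ps; rewrite (big_rem p.2) /=; last first.
  by apply: sB; rewrite !inE map_f.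
rewrite eqxx rem_filter ?fset_uniq // big_filter_cond big1 ?addr0 // => k /=.
by case/andP => /negPf; rewrite eq_sym => ->.
Unshelve. all: by end_near.
Qed.
End Expansion.

(** * Superlevel sets at transcendental levels *)

Section Superlevel.
Variables (R : realType) (n : nat) (e : intpoly n) (c : R).

Definition superlevel : set 'rV[R]_n := [set x | c < pfun e x].

Lemma superlevel_open : open superlevel.
Proof.
rewrite (_ : superlevel = pfun e @^-1` [set y | c < y]) //.
by apply: open_comp; [move=> x _; exact: pfun_continuous|exact: open_gt].
Qed.

Lemma closure_superlevel : closure superlevel `<=` [set x | c <= pfun e x].
Proof.
have cl : closed (pfun e @^-1` [set y : R | c <= y]).
  by apply: closed_comp; [move=> x _; exact: pfun_continuous|exact: closed_ge].
by move=> x clx; apply: cl; apply: closure_subset clx => y /ltW.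
Qed.

Lemma transcendental_regular x : transcendental c -> pfun e x = c ->
  exists i, pfun (pderiv i e) x != 0.
Proof.
move=> tc xc; apply: contrapT => crit.
apply: (@critical_value_not_transcendental n R (fun i => x 0 i) e).
  by move=> i; apply: contrapT => /eqP ?; apply: crit; exists i.
by rewrite -[peval _ _]/(pfun e x) xc.
Qed.

(** The defining function is c - e on the open set where some partial
    derivative of e is nonzero.  That set contains the level set {e = c}, and
    the nonzero derivative also shows that each point of the level set is a
    boundary point, not an interior one. *)
Lemma superlevel_analytic_boundary :
  transcendental c -> analytic_boundary superlevel.
Proof.
move=> tc.
have intE : superlevel° = superlevel.
  by apply/interior_id; exact: superlevel_open.
have boundaryE x : boundary superlevel x -> pfun e x = c.
  move=> [clx]; rewrite intE => /negP; rewrite -leNgt => xc.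
  by apply/eqP; rewrite eq_le xc; exact: closure_superlevel.
have derf (i : 'I_n) y :
    is_derive y (delta_mx 0 i) (fun x => c - pfun e x) (- pfun (pderiv i e) y).
  rewrite -[X in is_derive _ _ _ X]sub0r.
  exact: is_deriveB (is_derive_cst _ _ _) (is_derive_pfun e i y).
move=> x bx.
exists [set y | exists i, pfun (pderiv i e) y != 0], (fun y => c - pfun e y).
split.
- split; last exact/transcendental_regular/boundaryE.
  rewrite (_ : [set _ | _] =
      \bigcup_i (pfun (pderiv i e) @^-1` [set y : R | y != 0])).
    apply: bigcup_open => i _; apply: open_comp; last exact: open_neq.
    by move=> y _; exact: pfun_continuous.
  by apply/seteqP; split=> y /= [i]; [exists i|move=> _; exists i].
- apply: analytic_of_expandable => a.
  have -> : (fun y => c - pfun e y) =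
      (fun y : 'rV[R]_n => c + (-1) * pfun e y).
    by apply: funext => y; rewrite mulN1r.
  apply: expandableD; first exact: expandable_cst.
  by apply: expandableM; [exact: expandable_cst|exact: expandable_pfun].
- move=> y [i yi]; apply: contraNneq yi => /rowP/(_ i).
  by rewrite !mxE (derive_val (is_derive := derf i y)) => /eqP; rewrite oppr_eq0.
- by apply/seteqP; split=> y /=; rewrite subr_lt0 => -[].
- apply/seteqP; split=> y /= [].
    by move=> /boundaryE yc yU; split=> //; rewrite yc subrr.
  move=> yU fy0; have [i yi] := yU; split=> //; split.
    have := closure_neg_of_derive (derf i y).
    rewrite oppr_eq0 => /(_ yi fy0); apply: closure_subset => z /=.
    by rewrite subr_lt0.
  rewrite intE /superlevel /=.
  by move/eqP: fy0; rewrite subr_eq0 => /eqP ->; rewrite ltxx.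
Qed.
End Superlevel.

(** * Transcendental numbers are dense *)

Section Transcendental.
Variable R : realType.

Lemma finite_roots (p : {poly int}) : p != 0 ->
  finite_set [set c : R | (map_poly intr p).[c] = 0].
Proof.
move=> p0; apply: contrapT => /infinite_set_fset-/(_ (size p)) [B Bsub].
have mp0 : map_poly intr p != 0 :> {poly R}.
  by rewrite map_poly_eq0_id0 // intr_eq0 lead_coef_eq0.
rewrite leqNgt => /negP; apply.
have := @max_poly_roots _ _ (enum_fset B) mp0; rewrite size_map_inj_poly //.
  move=> -> //; last exact: fset_uniq.
  by apply/allP => c /Bsub /= c0; apply/rootP.
exact: intr_inj.
Qed.

(** The algebraic numbers are countable, hence of measure 0, so they do not
    fill an interval. *)
Lemma transcendental_between (a b : R) : a < b ->
  exists c, [/\ a < c, c < b & transcendental c].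
Proof.
move=> ab; apply: contrapT => noc.
pose alg : set R := \bigcup_(p in [set p : {poly int} | p != 0])
  [set c : R | (map_poly intr p).[c] = 0].
have alg_countable : countable alg.
  apply: bigcup_countable => [|p p0]; first exact: countableP.
  exact/finite_set_countable/finite_roots.
have sub : `]a, b[ `<=` alg.
  move=> c /=; rewrite in_itv /= => /andP[ac cb]; apply: contrapT => nalg.
  apply: noc; exists c; split=> // p p0; apply/eqP => pc; apply: nalg.
  by exists p.
have := countable_lebesgue_measure0 (sub_countable (subset_card_le sub)
  alg_countable).
rewrite lebesgue_measure_itv /= lte_fin ab -EFinD => /eqP.
by rewrite eqe subr_eq0 gt_eqF.
Qed.
End Transcendental.

(** * A polynomial that separates a set from the points far from it *)

Section Barrier.
Variables (R : realType) (n : nat).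
Implicit Types (x : 'rV[R]_n) (z : {ffun 'I_n -> int}) (e : intpoly n).

Lemma pfun_sum (I : Type) (r : seq I) (F : I -> intpoly n) x :
  pfun (\big[@PAdd n/PCst 0]_(i <- r) F i) x = \sum_(i <- r) pfun (F i) x.
Proof. exact: (big_morph (fun e => pfun e x)). Qed.

Definition ppow e k := iter k (PMul e) (PCst 1).

Lemma pfun_pow e k x : pfun (ppow e k) x = pfun e x ^+ k.
Proof. by elim: k => [|k IH] //; rewrite exprS -IH. Qed.

(** The squared Euclidean distance from x to the rational point z / q, scaled by
    q ^ 2 so that its coefficients are integers. *)
Definition sqdist (q : nat) z x : R :=
  \sum_(i < n) (q%:R * x 0 i - (z i)%:~R) ^+ 2.

Definition psqdist (q : nat) z : intpoly n :=
  \big[@PAdd n/PCst 0]_(i <- index_enum 'I_n)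
    ppow (PAdd (PMul (PCst q%:Z) (PVar i)) (PCst (- z i))) 2.

Lemma pfun_sqdist q z x : pfun (psqdist q z) x = sqdist q z x.
Proof.
rewrite pfun_sum; apply: eq_bigr => i _.
by rewrite pfun_pow /pfun /= rmorphN.
Qed.

(** Since Num.max u 0 < v, the quotient of the two powers tends to 0. *)
Lemma odd_power_gap (M : nat) (u v : R) : u < v -> 0 < v ->
  exists N, odd N /\ M%:R * Num.max u 0 ^+ N < v ^+ N.
Proof.
move=> uv v0; set w := Num.max u 0.
have w0 : 0 <= w by rewrite le_max lexx orbT.
have wv : `|w / v| < 1.
  by rewrite ger0_norm ?divr_ge0 ?(ltW v0) // ltr_pdivrMr // mul1r gt_max uv.
have : M%:R * (w / v) ^+ N @[N --> \oo] --> M%:R * (0 : R).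
  by apply: cvgM; [exact: cvg_cst|exact: cvg_expr].
rewrite mulr0 => /cvgr_lt-/(_ 1 ltr01) [N0 _ small].
exists N0.*2.+1; split; first by rewrite /= odd_double.
have N0le : (N0 <= N0.*2.+1)%N by rewrite -addnn -addnS leq_addr.
have : M%:R * (w / v) ^+ (N0.*2.+1) < 1 := small _ N0le.
by rewrite expr_div_n mulrA ltr_pdivrMr ?exprn_gt0 // mul1r.
Qed.

(** G is a superlevel set of F x := \sum_(z <- s) (L - sqdist q z x) ^+ N, for N
    odd and large.  If sqdist q z x is at most s0 for some z, and at most L for
    all of them, then F x >= (L - s0) ^+ N, because the other terms of the sum
    are nonnegative.  If it is at least s1 for every z, then each term is at
    most Num.max (L - s1) 0 ^+ N; as N is odd, this holds even where
    L - sqdist q z x is very negative, and so G does not reach infinity.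
    For N large the first bound exceeds the sum of the second ones, and a
    transcendental level fits between them. *)
Lemma analytic_barrier (q s0 s1 L : nat) (s : seq {ffun 'I_n -> int}) :
  (s0 < s1)%N -> (s0 < L)%N ->
  exists G : set 'rV[R]_n,
    [/\ open G, analytic_boundary G,
        forall x, (exists2 z, z \in s & sqdist q z x <= s0%:R) ->
          (forall z, z \in s -> sqdist q z x <= L%:R) -> G x
      & forall x, closure G x -> exists2 z, z \in s & sqdist q z x < s1%:R].
Proof.
move=> s01 s0L.
have u01 : L%:R - s1%:R < L%:R - s0%:R :> R by rewrite ltrD2l ltrN2 ltr_nat.
have v0 : 0 < L%:R - s0%:R :> R by rewrite subr_gt0 ltr_nat.
have [N [oddN gap]] := odd_power_gap (size s) u01 v0.
set w := Num.max _ _ in gap.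
have [c [clow chigh tc]] := transcendental_between gap.
pose e : intpoly n := \big[@PAdd n/PCst 0]_(z <- s)
  ppow (PAdd (PCst L%:Z) (PMul (PCst (-1)) (psqdist q z))) N.
have eE x : pfun e x = \sum_(z <- s) (L%:R - sqdist q z x) ^+ N.
  rewrite pfun_sum; apply: eq_bigr => z _; rewrite pfun_pow; congr (_ ^+ _).
  rewrite -[LHS]/((Posz L)%:~R + (-1)%:~R * pfun (psqdist q z) x) pfun_sqdist.
  by rewrite mulN1r.
exists (superlevel e c); split.
- exact: superlevel_open.
- exact: superlevel_analytic_boundary.
- move=> x [z zs zx] xL; rewrite /superlevel /= eE.
  apply: (lt_le_trans chigh); rewrite (big_rem z) //= -[leLHS]addr0 lerD //.
    apply: lerXn2r; rewrite ?nnegrE ?lerD2l ?lerN2 //; first exact: ltW.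
    by rewrite subr_ge0 xL.
  rewrite big_seq; apply: sumr_ge0 => y /mem_rem ys.
  by rewrite exprn_ge0 // subr_ge0 xL.
- move=> x /closure_superlevel /=; rewrite eE => cF; apply: contrapT => far.
  suff : \sum_(z <- s) (L%:R - sqdist q z x) ^+ N <= (size s)%:R * w ^+ N.
    by move=> /(le_lt_trans)/(_ clow); rewrite ltNge cF.
  rewrite mulr_natl -sum1_size -sumrMnr big_seq [leRHS]big_seq.
  apply: ler_sum => z zs; rewrite mulr1n.
  have zx : L%:R - sqdist q z x <= w.
    have s1d : s1%:R <= sqdist q z x.
      by rewrite leNgt; apply/negP => near_z; apply: far; exists z.
    by rewrite le_max lerD2l lerN2 s1d.
  have [neg|pos] := leP (L%:R - sqdist q z x) 0; last first.
    by apply: lerXn2r zx; rewrite nnegrE ?(ltW pos) // le_max lexx orbT.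
  apply: (@le_trans _ _ 0); first by rewrite exprn_odd_le0.
  by rewrite exprn_ge0 // le_max lexx orbT.
Qed.
End Barrier.

(** * Exhaustion of an open set *)

Section Exhaustion.
Variables (R : realType) (n : nat).
Implicit Types (x y : 'rV[R]_n) (z : {ffun 'I_n -> int}) (Omega : set 'rV[R]_n).

Lemma coord_le_norm x (i : 'I_n) : `|x 0 i| <= `|x|.
Proof.
rewrite [leRHS]/Num.norm /= mx_normrE.
exact: (le_bigmax_cond _ (fun ij => `|x ij.1 ij.2|) (j := (0, i))).
Qed.

Lemma norm_le_coord x r : 0 <= r -> (forall i, `|x 0 i| <= r) -> `|x| <= r.
Proof.
move=> r0 xr; rewrite [leLHS]/Num.norm /= mx_normrE.
by apply/bigmax_leP; split=> // -[j i] _ /=; rewrite (ord1 j).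
Qed.

(** The points of norm at most 2 ^+ m whose distance to the complement of Omega
    is at least 2 ^- m. *)
Definition core Omega m : set 'rV[R]_n :=
  [set x | `|x| <= 2 ^+ m /\ forall y, `|y - x| < 2 ^- m -> Omega y].

Lemma core_sub Omega m : core Omega m `<=` Omega.
Proof. by move=> x [_]; apply; rewrite subrr normr0 invr_gt0 exprn_gt0. Qed.

Lemma cover_core Omega : open Omega -> Omega `<=` \bigcup_m core Omega m.
Proof.
move=> openO x Ox.
have /nbhs_ballP[r /= r0 rO] : nbhs x Omega by exact: open_nbhs_nbhs.
have pow_large (b : R) : exists m, b <= 2 ^+ m.
  exists (Num.truncn b).+1; apply: ltW; apply: (lt_trans (truncnS_gt b)).
  by rewrite -natrX ltr_nat ltn_expl.
have [m1 xm1] := pow_large `|x|; have [m2 rm2] := pow_large r^-1.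
exists (maxn m1 m2) => //; split.
  by apply: (le_trans xm1); rewrite ler_weXn2l ?ler1n ?leq_maxl.
move=> y yx; apply: rO; rewrite mx_norm_ball /ball_ /= distrC.
apply: (lt_le_trans yx).
rewrite -[leRHS]invrK lef_pV2 ?posrE ?invr_gt0 ?exprn_gt0 //.
by apply: (le_trans rm2); rewrite ler_weXn2l ?ler1n ?leq_maxr.
Qed.

Lemma core_succ Omega m x x' : core Omega m x' -> `|x - x'| <= 2 ^- m.+1 ->
  core Omega m.+1 x.
Proof.
move=> [x'm x'O] xx'.
have half : 2 ^- m = 2 ^- m.+1 + 2 ^- m.+1 :> R.
  by rewrite exprS invfM; field; rewrite expf_neq0.
split.
  have -> : x = (x - x') + x' by rewrite subrK.
  apply: (le_trans (ler_normD _ _)); rewrite exprS mulr_natl mulr2n lerD //.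
  apply: (le_trans xx'); apply: (@le_trans _ _ 1).
    by rewrite invf_le1 ?exprn_gt0 // exprn_ege1 // ler1n.
  by rewrite exprn_ege1 // ler1n.
move=> y yx; apply: x'O.
have -> : y - x' = (y - x) + (x - x') by rewrite addrA subrK.
by apply: (le_lt_trans (ler_normD _ _)); rewrite half ltr_leD.
Qed.

Definition grid_near (q : nat) x z :=
  forall i, `|q%:R * x 0 i - (z i)%:~R| <= 1.

Lemma exists_grid_near q x : exists z, grid_near q x z.
Proof.
exists [ffun i => Num.floor (q%:R * x 0 i)] => i; rewrite ffunE.
have /andP[lo hi] := floor_itv (q%:R * x 0 i).
rewrite ger0_norm ?subr_ge0 // lerBlDl ltW //.
by move: hi; rewrite intrD addrC.
Qed.

Lemma finite_grid_near (q b : nat) (E : set 'rV[R]_n) :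
  (forall x, E x -> `|x| <= b%:R) ->
  exists s : seq {ffun 'I_n -> int},
    forall z, z \in s <-> exists2 x, E x & grid_near q x z.
Proof.
move=> Eb; pose B := (q * b).+1.
pose shift_back (f : {ffun 'I_n -> 'I_(2 * B).+1}) : {ffun 'I_n -> int} :=
  [ffun i => Posz (f i) - Posz B].
pose grid := [seq shift_back f | f : {ffun 'I_n -> 'I_(2 * B).+1}].
exists [seq z <- grid | `[< exists2 x, E x & grid_near q x z >]] => z.
rewrite mem_filter; split=> [/andP[/asboolP]//|near_z].
apply/andP; split; first exact/asboolP.
have [x Ex xz] := near_z.
have zB i : `|z i| <= B%:Z.
  rewrite -(ler_int R) intr_norm.
  have -> : (z i)%:~R = q%:R * x 0 i - (q%:R * x 0 i - (z i)%:~R) :> R.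
    by rewrite subKr.
  apply: (le_trans (ler_normB _ _)).
  have -> : (Posz B)%:~R = q%:R * b%:R + 1 :> R by rewrite -natrM natr1.
  rewrite lerD // normrM normr_nat ler_wpM2l //.
  exact: le_trans (coord_le_norm x i) (Eb _ Ex).
apply/mapP; exists [ffun i => inord (absz (z i + B%:Z))].
  by rewrite mem_enum.
apply/ffunP => i; rewrite !ffunE.
have := zB i; rewrite ler_norml => /andP[]; move: (z i) => k.
move=> lo hi; have [k' kE] : exists k' : nat, k + B%:Z = k'%:Z.
  by exists (absz (k + B%:Z)); lia.
by rewrite kE absz_nat inordK; lia.
Qed.

(** The barrier is built from the points of the grid of mesh 1 / q near the
    core.  Each point of the core has a grid point within 1 / q in each
    coordinate, where sqdist is at most n.  A point where some sqdist is below
    4 * n is within 2 * n / q of a grid point in each coordinate, hence within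
    (2 * n + 1) / q of the core, and q makes that bound equal to 2 ^- m.+1. *)
Lemma analytic_between_cores Omega m : (0 < n)%N ->
  exists G : set 'rV[R]_n,
    [/\ open G, analytic_boundary G, core Omega m `<=` G
      & closure G `<=` core Omega m.+1].
Proof.
move=> n0; pose q := ((2 * n).+1 * 2 ^ m.+1)%N.
have q0 : (0 < q)%N by rewrite muln_gt0 expn_gt0.
have coreb x : core Omega m x -> `|x| <= (2 ^ m)%N%:R by rewrite natrX; case.
have [s sP] := finite_grid_near q coreb.
(* bounds the coordinates of q * x - z, for x in the core and z in s *)
pose b := ((2 ^ m) * (q + q)).+1.
(* 4 * n <= (2 * n) ^ 2, so sqdist < 4 * n controls each coordinate by 2 * n *)
have [||G [openG anG nearG farG]] :=
  @analytic_barrier R n q n (4 * n) (n * b ^ 2).+1 s.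
- by rewrite ltn_Pmull.
- by rewrite ltnS leq_pmulr // expn_gt0.
exists G; split=> // x.
- move=> cx; apply: nearG.
    have [z xz] := exists_grid_near q x; exists z; first by apply/sP; exists x.
    rewrite -[n in leRHS]card_ord -sumr_const; apply: ler_sum => i _.
    by rewrite -real_normK ?num_real // exprn_ile1.
  move=> z /sP[x' cx' x'z].
  have le_b i : (q%:R * x 0 i - (z i)%:~R) ^+ 2 <= (b ^ 2)%N%:R.
    rewrite natrX -real_normK ?num_real // lerXn2r ?nnegrE //.
    have -> : q%:R * x 0 i - (z i)%:~R =
        q%:R * (x 0 i - x' 0 i) + (q%:R * x' 0 i - (z i)%:~R) by ring.
    apply: (le_trans (ler_normD _ _)); rewrite /b -natr1 lerD //.
    rewrite normrM normr_nat mulnDr -mulnDl natrM mulrC natrD ler_wpM2r //.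
    apply: (le_trans (ler_normB _ _)).
    by rewrite lerD // (le_trans (coord_le_norm _ _)) ?coreb.
  apply: (@le_trans _ _ (n * b ^ 2)%N%:R); last by rewrite ler_nat.
  rewrite mulnC natrM mulr_natr -[n in leRHS]card_ord -sumr_const.
  by apply: ler_sum => i _; exact: le_b.
- move=> /farG[z /sP[x' cx' x'z] far].
  apply: (core_succ cx').
  apply: norm_le_coord => [|i]; first by rewrite invr_ge0 exprn_ge0.
  have zx : `|q%:R * x 0 i - (z i)%:~R| <= (2 * n)%:R.
    rewrite -(ler_pXn2r (n := 2)) ?nnegrE // real_normK ?num_real //.
    apply: (@le_trans _ _ (4 * n)%:R); last first.
      by rewrite -natrX ler_nat expnMn leq_pmul2l // -mulnn leq_pmulr.
    apply: le_trans (ltW far); rewrite /sqdist (bigD1 i) //= lerDl.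
    by apply: sumr_ge0 => j _; exact: sqr_ge0.
  rewrite -(ler_pM2l (x := q%:R)) ?ltr0n //.
  rewrite -[q%:R in leLHS]normr_nat -normrM !mxE.
  have -> : q%:R * (x 0 i - x' 0 i) =
      (q%:R * x 0 i - (z i)%:~R) - (q%:R * x' 0 i - (z i)%:~R) by ring.
  have -> : q%:R * 2 ^- m.+1 = (2 * n)%:R + 1 :> R.
    by rewrite /q natrM natrX mulfK ?expf_neq0 // -addn1 natrD.
  exact: le_trans (ler_normB _ _) (lerD zx (x'z i)).
Qed.

End Exhaustion.

Theorem theorem1 (R : realType) (n : nat) (n_ge1 : (1 <= n)%N)
    (Omega : set 'rV[R]_n) (Omega_open : open Omega) :
  exists Om : nat -> set 'rV[R]_n,
    [/\ forall m, (1 <= m)%N ->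
          [/\ open (Om m), bounded_set (Om m) & analytic_boundary (Om m)],
        forall m, (1 <= m)%N -> Om m `<=` Om m.+1,
        \bigcup_(m in [set m | (1 <= m)%N]) Om m = Omega
      & forall m, (1 <= m)%N -> closure (Om m) `<=` Omega].
Proof.
have /choice[Om OmP] m := analytic_between_cores Omega m n_ge1.
have upper m : Om m `<=` core Omega m.+1.
  by have [_ _ _] := OmP m; apply: subset_trans; exact: subset_closure.
have succ m : Om m `<=` Om m.+1.
  by have [_ _ lower _] := OmP m.+1; exact: subset_trans (upper m) lower.
exists Om; split=> [m _|m _|| m _] //.
- have [openOm anOm _ _] := OmP m; split=> //.
  exists (2 ^+ m.+1); split; first exact: num_real.
  by move=> M ltM x /upper[xb _]; exact: le_trans xb (ltW ltM).
- apply/seteqP; split=> [x [m _ /upper/core_sub]//|x].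
  move=> /(cover_core Omega_open)[m _ xm].
  have [_ _ lower _] := OmP m.
  by exists m.+1 => //; apply: succ; exact: lower.
- have [_ _ _ clOm] := OmP m.
  exact: subset_trans clOm (@core_sub _ _ _ _).
Qed.
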